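(* For $n\ge1$ and $1\le k\le n$, let $\mathcal{A}_{n,k}$ be the set of partitions of $n$ into even parts with largest part at most $2k$, and $\mathcal{B}_{n,k}$ the set of partitions of $n$ into even parts with at most $k$ parts. Let $\vartheta_n:\mathcal{A}_{n,k}\to\mathcal{B}_{n,k}$ be the map which divides each part of $\lambda\in\mathcal{A}_{n,k}$ by $2$, doubles the resulting multiplicities, and takes the conjugate partition. Then $\vartheta_n$ is an MP-bijection.
   Context: Here $U$ denotes the set of allowed part sizes of the domain (the even positive integers). A bijection $\vartheta_n:\mathcal{A}_n\to\mathcal{B}_n$ between sets of partitions of $n$ is an MP-bijection if there are real coefficients $v(i,j)$, $1\le i,j\le n$, such that for every $\lambda\in\mathcal{A}_n$ with $m_j$ parts equal to $j$, the image $\mu=\vartheta_n(\lambda)$ has parts $\mu_i=\sum_{j=1}^nv(i,j)m_j\ge0$ ($i=1,\dots,n$, listed in nonincreasing order, zeros allowed), and $\sum_iv(i,j)=j$ when $j\in U$ and $\sum_iv(i,j)=0$ otherwise, for all $j$. The conjugate $\lambda'$ of $\lambda$ has $\lambda'_i=\#\{j:\lambda_j\ge i\}$. *)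

(* Defs.v *)
From mathcomp Require Import all_boot all_order all_algebra.
From mathcomp Require Import boolp classical_sets functions reals.

Set Implicit Arguments.
Unset Strict Implicit.
Unset Printing Implicit Defensive.

Local Open Scope classical_set_scope.

(* A partition is the nonincreasing sequence of its (positive) parts. *)
Definition partitions (n : nat) : set (seq nat) :=
  [set lam | [/\ sorted geq lam, all (leq 1) lam & sumn lam = n]].

(* [nth 0 (conj_part lam) i.-1] is lambda'_i: the parts of lambda' beyond the
   largest part of lambda are zero and are dropped. *)
Definition conj_part (lam : seq nat) : seq nat :=
  [seq count (leq i) lam | i <- iota 1 (\max_(p <- lam) p)].

Definition even_pos : pred nat := [pred j | (0 < j) && ~~ odd j].

Definition partsA (n k : nat) : set (seq nat) :=
  [set lam | [/\ partitions n lam, all even_pos lam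
               & \max_(p <- lam) p <= k.*2]].

Definition partsB (n k : nat) : set (seq nat) :=
  [set mu | [/\ partitions n mu, all even_pos mu & size mu <= k]].

Definition halve_parts (lam : seq nat) : seq nat := [seq p./2 | p <- lam].

Definition double_mult (lam : seq nat) : seq nat :=
  flatten [seq nseq 2 p | p <- lam].

Definition theta (lam : seq nat) : seq nat :=
  conj_part (double_mult (halve_parts lam)).

(* Indices are 1-based; [v] is only used at 1 <= i, j <= n. Reading [f lam] with
   default 0 pads it with zeros up to n parts, which loses nothing because a
   partition of n has at most n positive parts. *)
Definition MP_bijection (R : realType) (n : nat) (U : pred nat)
    (A B : set (seq nat)) (f : seq nat -> seq nat) : Prop :=
  [/\ A `<=` partitions n, B `<=` partitions n, set_bij A B f &
   exists v : nat -> nat -> R,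
     (forall lam, A lam -> forall i, 1 <= i <= n ->
        ((nth 0%N (f lam) i.-1)%:R
           = \sum_(1 <= j < n.+1) v i j * (count_mem j lam)%:R)%R /\
        (0 <= \sum_(1 <= j < n.+1) v i j * (count_mem j lam)%:R)%R) /\
     (forall j, 1 <= j <= n ->
        (\sum_(1 <= i < n.+1) v i j = if U j then j%:R else 0)%R)].

(* Main.v *)
Require Import Defs.
From mathcomp Require Import all_boot all_order all_algebra.
From mathcomp Require Import boolp classical_sets functions reals.
From mathcomp Require Import zify.

(** Doubling all multiplicities before conjugating amounts to doubling all
    parts afterwards, so [theta] is conjugation transported along the bijection
    [p |-> 2 p] between partitions and partitions into even parts. Hence it is
    an involution exchanging half the largest part with the number of parts.
    The i-th part of [theta lam] is twice the number of parts of [lam] that are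
    at least [2 i], so [v i j] is 2 when [j] is even and [2 i <= j], and 0
    otherwise. *)

Import GRing.Theory Num.Theory.

(** * Conjugation of partitions *)

Lemma count_leq_iota1 (p m : nat) : count (fun j => j <= p) (iota 1 m) = minn p m.
Proof.
elim: m => [|m IHm]; first by rewrite minn0.
by rewrite -[m.+1]addn1 iotaD count_cat IHm /=; lia.
Qed.

Lemma leq_bigmax_mem (s : seq nat) (p : nat) : p \in s -> p <= \max_(q <- s) q.
Proof. by move=> ps; exact: (@leq_bigmax_seq _ s xpredT id p ps isT). Qed.

Lemma size_conj_part (s : seq nat) : size (conj_part s) = \max_(p <- s) p.
Proof. by rewrite size_map size_iota. Qed.

Lemma nth_conj_part (s : seq nat) (i : nat) :
  nth 0 (conj_part s) i = count (leq i.+1) s.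
Proof.
have [lt_i|le_i] := ltnP i (\max_(p <- s) p).
  by rewrite (nth_map 0) ?size_iota // nth_iota.
(* Past the largest part no part is counted, which agrees with the default 0. *)
rewrite nth_default ?size_conj_part //; apply/esym/eqP.
rewrite -leqn0 leqNgt -has_count; apply/hasPn => p /leq_bigmax_mem; lia.
Qed.

Lemma sorted_conj_part (s : seq nat) : sorted geq (conj_part s).
Proof.
apply/(sortedP 0) => i _; rewrite !nth_conj_part.
by apply: sub_count => p /=; lia.
Qed.

Lemma conj_part_pos (s : seq nat) : all (leq 1) (conj_part s).
Proof.
apply/(all_nthP 0) => i; rewrite size_conj_part nth_conj_part -has_count => lt_i.
apply/negPn/negP => /hasPn s_le.
suff: \max_(p <- s) p <= i by lia.
by apply/bigmax_leqP_seq => p /s_le; lia.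
Qed.

(** Double counting of the cells of the Young diagram, by columns and by rows. *)
Lemma sumn_conj_part (s : seq nat) : sumn (conj_part s) = sumn s.
Proof.
rewrite /conj_part sumnE big_map.
under eq_bigr => i _ do rewrite -sum1_count big_mkcond /=.
(* Restricting to [p] in [s] gives [p <= max], so the row of [p] is counted in full. *)
rewrite exchange_big sumnE /= big_seq [RHS]big_seq.
apply: eq_bigr => p /leq_bigmax_mem le_p.
by rewrite -big_mkcond sum1_count count_leq_iota1 (minn_idPl le_p).
Qed.

(** In a nonincreasing sequence the entries at least [j] form an initial segment. Since [j > 0], the
    default 0 past the end is never counted. *)
Lemma ltn_count_leq_sorted (s : seq nat) (i j : nat) :
  sorted geq s -> 0 < j -> (i < count (leq j) s) = (j <= nth 0 s i).
Proof.
have geq_trans : transitive geq by move=> a b c /=; lia.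
elim: s i => [|a s IHs] i /=; first by rewrite nth_nil; lia.
rewrite path_sortedE // => /andP[/allP a_ge s_sorted] j_gt0.
case: i => [|i] /=; last first.
  have := IHs i s_sorted j_gt0.
  case: (leqP j a) => [//|lt_aj]; rewrite add0n => <-.
  (* The head is below [j], hence so is the whole tail. *)
  suff -> : count (leq j) s = 0 by [].
  apply/eqP; rewrite -leqn0 leqNgt -has_count.
  by apply/hasPn => p /a_ge /=; lia.
case: (leqP j a) => // lt_aj.
rewrite add0n -has_count; apply/hasPn => p /a_ge /=; lia.
Qed.

Lemma bigmax_conj_part (s : seq nat) :
  all (leq 1) s -> \max_(p <- conj_part s) p = size s.
Proof.
move=> s_pos; apply/eqP; rewrite eqn_leq; apply/andP; split.
  by apply/bigmax_leqP_seq => _ /mapP[i _ ->] _; exact: count_size.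
(* All parts are positive, so the first entry of the conjugate counts every one of them. *)
have nth0 : nth 0 (conj_part s) 0 = size s.
  by rewrite nth_conj_part; apply/eqP; rewrite -all_count.
rewrite -nth0; case: (conj_part s) => [|a t] //=.
by apply: leq_bigmax_mem; rewrite mem_head.
Qed.

(** The entry of the double conjugate at position [i] counts the [j >= 1] whose conjugate entry
    exceeds [i], that is, those with [j <= nth 0 s i]. *)
Lemma conj_partK (s : seq nat) :
  sorted geq s -> all (leq 1) s -> conj_part (conj_part s) = s.
Proof.
move=> s_sorted s_pos; apply: (@eq_from_nth _ 0).
  by rewrite size_conj_part bigmax_conj_part.
move=> i; rewrite size_conj_part bigmax_conj_part // => lt_i.
rewrite nth_conj_part count_map.
rewrite (@eq_in_count _ _ (fun j => j <= nth 0 s i)); last first.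
  move=> j; rewrite mem_iota => /andP[j_gt0 _] /=.
  exact: ltn_count_leq_sorted.
by rewrite count_leq_iota1; apply/minn_idPl/leq_bigmax_mem/mem_nth.
Qed.

(** * Doubling and halving *)

Lemma count_double_mult (P : pred nat) (s : seq nat) :
  count P (double_mult s) = (count P s).*2.
Proof. by elim: s => //= a s; rewrite /double_mult /= => ->; lia. Qed.

Lemma bigmax_double_mult (s : seq nat) :
  \max_(p <- double_mult s) p = \max_(p <- s) p.
Proof.
elim: s => //= a s; rewrite /double_mult /= !big_cons => ->.
by rewrite maxnA maxnn.
Qed.

Lemma thetaE (lam : seq nat) :
  theta lam = map double (conj_part (halve_parts lam)).
Proof.
rewrite /theta /conj_part bigmax_double_mult -map_comp.
by apply: eq_map => i; exact: count_double_mult.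
Qed.

Lemma map_doubleK : cancel (map double) halve_parts.
Proof. exact/mapK/doubleK. Qed.

Lemma halve_partsK (s : seq nat) :
  all even_pos s -> map double (halve_parts s) = s.
Proof. by elim: s => //= a s IHs /andP[/andP[_ ?] /IHs ->]; congr cons; lia. Qed.

Lemma halve_parts_pos (s : seq nat) :
  all even_pos s -> all (leq 1) (halve_parts s).
Proof. by rewrite all_map; apply: sub_all => p /andP[/=]; lia. Qed.

Lemma sorted_halve_parts (s : seq nat) :
  sorted geq s -> sorted geq (halve_parts s).
Proof. by apply: homo_sorted => a b /=; lia. Qed.

Lemma sumn_map_double (s : seq nat) : sumn (map double s) = (sumn s).*2.
Proof. by elim: s => //= a s ->; lia. Qed.

Lemma bigmax_map_double (s : seq nat) :
  \max_(p <- map double s) p = (\max_(p <- s) p).*2.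
Proof.
elim: s => [|a s IHs]; first by rewrite !big_nil.
by rewrite /= !big_cons IHs -!mul2n -maxnMr.
Qed.

(** * Bijectivity of [theta] *)

Lemma all_even_pos_theta (lam : seq nat) : all even_pos (theta lam).
Proof.
rewrite thetaE all_map; apply: sub_all (conj_part_pos _) => p p_gt0.
by rewrite /= /even_pos /= double_gt0 p_gt0 odd_double.
Qed.

Lemma sumn_theta (lam : seq nat) : all even_pos lam -> sumn (theta lam) = sumn lam.
Proof.
move=> lam_even.
by rewrite thetaE sumn_map_double sumn_conj_part -sumn_map_double halve_partsK.
Qed.

Lemma partitions_theta (n : nat) (lam : seq nat) :
  partitions n lam -> all even_pos lam -> partitions n (theta lam).
Proof.
move=> [_ _ lam_sum] lam_even; split; last by rewrite sumn_theta.
  rewrite thetaE; apply: homo_sorted (sorted_conj_part _) => a b /=; lia.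
by apply: sub_all (all_even_pos_theta lam) => p /andP[].
Qed.

Lemma thetaK (lam : seq nat) :
  sorted geq lam -> all even_pos lam -> theta (theta lam) = lam.
Proof.
move=> lam_sorted lam_even.
rewrite [theta lam]thetaE thetaE map_doubleK conj_partK ?halve_partsK //.
  exact: sorted_halve_parts.
exact: halve_parts_pos.
Qed.

Lemma size_theta (lam : seq nat) :
  all even_pos lam -> (size (theta lam)).*2 = \max_(p <- lam) p.
Proof.
move=> lam_even.
by rewrite thetaE size_map size_conj_part -bigmax_map_double halve_partsK.
Qed.

Lemma bigmax_theta (lam : seq nat) :
  all even_pos lam -> \max_(p <- theta lam) p = (size lam).*2.
Proof.
move=> lam_even.
by rewrite thetaE bigmax_map_double bigmax_conj_part ?size_map ?halve_parts_pos.
Qed.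

Lemma theta_set_bij (n k : nat) : set_bij (partsA n k) (partsB n k) theta.
Proof.
split.
- move=> lam [lam_part lam_even lam_max]; split.
  + exact: partitions_theta.
  + exact: all_even_pos_theta.
  + by rewrite -leq_double size_theta.
- move=> lam mu /set_mem[[lam_sorted _ _] lam_even _].
  move=> /set_mem[[mu_sorted _ _] mu_even _] eq_theta.
  by rewrite -(thetaK lam) // eq_theta thetaK.
- move=> mu [mu_part mu_even mu_size]; exists (theta mu); last first.
    by case: mu_part => *; exact: thetaK.
  split; first exact: partitions_theta.
    exact: all_even_pos_theta.
  by rewrite bigmax_theta // leq_double.
Qed.

(** * The coefficients *)

Lemma nth_theta (lam : seq nat) (i : nat) :
  nth 0 (theta lam) i = (count (leq i.+1.*2) lam).*2.
Proof.
rewrite /theta nth_conj_part count_double_mult count_map; congr double.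
by apply: eq_count => p /=; lia.
Qed.

Lemma count_sum_count_mem (P : pred nat) (s : seq nat) (n : nat) :
  all (fun p => 1 <= p <= n) s ->
  count P s = \sum_(1 <= j < n.+1) P j * count_mem j s.
Proof.
elim: s => [|a s IHs] /=; first by rewrite big1 // => j _; rewrite muln0.
move=> /andP[a_bnd /IHs ->]; under [RHS]eq_bigr do rewrite mulnDr.
rewrite big_split /=; congr (_ + _).
(* The new element [a] contributes only to the term [j = a], which lies in the range by the bound on
   [a]. *)
rewrite (bigD1_seq a) ?iota_uniq ?mem_index_iota //= eqxx muln1.
by rewrite big1 ?addn0 // => j; rewrite eq_sym => /negPf ->; rewrite muln0.
Qed.

Lemma mem_leq_sumn (s : seq nat) (p : nat) : p \in s -> p <= sumn s.
Proof.
elim: s => //= a s IHs; rewrite inE => /orP[/eqP ->|/IHs]; lia.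
Qed.

(** The factor [even_pos j] makes the column sums vanish for [j] outside the allowed part sizes. *)
Definition theta_coef (i j : nat) : nat := (even_pos j && (i.*2 <= j)).*2.

Lemma nth_theta_coef (n : nat) (lam : seq nat) (i : nat) :
  partitions n lam -> all even_pos lam -> 0 < i ->
  nth 0 (theta lam) i.-1 = \sum_(1 <= j < n.+1) theta_coef i j * count_mem j lam.
Proof.
move=> [_ lam_pos lam_sum] lam_even i_gt0; rewrite nth_theta prednK //.
rewrite (@eq_in_count _ _ (fun j => even_pos j && (i.*2 <= j))); last first.
  by move=> p /(allP lam_even) ->.
rewrite (@count_sum_count_mem _ _ n); last first.
  apply/allP => p lam_p; rewrite (allP lam_pos) //= -lam_sum.
  exact: mem_leq_sumn.
by rewrite -mul2n big_distrr; apply: eq_bigr => j _; rewrite /= mulnA mul2n.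
Qed.

(** For even [j], the indices with [2 i <= j] are [1, ..., j/2], all at most [n], and each
    contributes 2. *)
Lemma sum_theta_coef (n j : nat) :
  j <= n -> \sum_(1 <= i < n.+1) theta_coef i j = if even_pos j then j else 0.
Proof.
move=> le_jn; rewrite /theta_coef; case: ifP => [j_even|_] /=; last by rewrite big1.
under eq_bigr => i _ do rewrite -mul2n.
have count_half : \sum_(1 <= i < n.+1) (i.*2 <= j) = minn j./2 n.
  rewrite -count_leq_iota1 -sum1_count [RHS]big_mkcond /index_iota subn1.
  by apply: eq_bigr => i _; rewrite -geq_half_double; case: leqP.
rewrite -big_distrr /= count_half.
by case/andP: j_even => _; lia.
Qed.

Theorem theorem9p3 (R : realType) (n k : nat) (hn : 1 <= n) (hk : 1 <= k <= n) :
  MP_bijection R n even_pos (partsA n k) (partsB n k) theta.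
Proof.
split; [by move=> lam [] | by move=> mu [] | exact: theta_set_bij |].
exists (fun i j => (theta_coef i j)%:R%R); split; last first.
  by move=> j /andP[_ le_jn]; rewrite -natr_sum sum_theta_coef //; case: ifP.
move=> lam [lam_part lam_even _] i /andP[i_gt0 _].
(* The real sum is the cast of a natural number, so nonnegativity is immediate. *)
under eq_bigr => j _ do rewrite -natrM.
rewrite -natr_sum -nth_theta_coef //; split=> //; exact: ler0n.
Qed.
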